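(* There is a universal constant $C>0$ such that the following holds. For every tabular and episodic MDP with deterministic transitions (each $P_h(\cdot|s,a)$ is a point mass) and deterministic expert policy $\pi^{E}$, and every $\varepsilon\in(0,H]$, if the number $m$ of expert trajectories satisfies $m\ge C|\mathcal S|H/\varepsilon$, then the behavioral cloning policy $\pi^{\mathrm{BC}}$ satisfies $V^{\pi^{E}}-\mathbb E[V^{\pi^{\mathrm{BC}}}]\le\varepsilon$, where the expectation is over the random expert dataset. (That is, BC requires at most $O(|\mathcal S|H/\varepsilon)$ expert trajectories in expectation.)
   Context: A tabular episodic MDP is a tuple $(\mathcal S,\mathcal A,P,r,H,\rho)$ with finite $\mathcal S,\mathcal A$, horizon $H$, time-dependent transitions $P_h(s'|s,a)$, rewards $r_h:\mathcal S\times\mathcal A\to[0,1]$, and (possibly random) initial state distribution $\rho$. A policy is $\pi=(\pi_1,\dots,\pi_H)$, $\pi_h:\mathcal S\to\Delta(\mathcal A)$; $V^\pi$ is its expected total reward over $H$ steps. The dataset $\mathcal D$ consists of $m$ i.i.d. length-$H$ trajectories generated by $\pi^{E}$. Behavioral cloning (BC) minimizes, over all policies, $\sum_{h=1}^H\sum_{(s_h,a_h)\in\mathcal D}|\pi_h(a_h|s_h)-\widehat\pi^{E}_h(a_h|s_h)|$, where $\widehat\pi^{E}_h(a|s)$ is the empirical frequency of action $a$ among trajectories in $\mathcal D$ visiting $s$ at step $h$, and by convention it plays the uniform distribution on unvisited states; thus $\pi^{\mathrm{BC}}_h(a|s)=\widehat\pi^{E}_h(a|s)$ if $s$ is visited at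 step $h$ in $\mathcal D$, and $\pi^{\mathrm{BC}}_h(a|s)=1/|\mathcal A|$ otherwise. *)

(* Defs.v *)
From mathcomp Require Import all_boot all_order all_algebra.
From mathcomp Require Import reals.

Set Implicit Arguments.
Unset Strict Implicit.
Unset Printing Implicit Defensive.

Import Order.TTheory GRing.Theory Num.Theory.
Local Open Scope ring_scope.

Record fdist (R : realType) (T : finType) := FDist {
  pmf :> T -> R;
  pmf_ge0 : forall x, 0 <= pmf x;
  pmf_sum1 : \sum_x pmf x = 1
}.

Definition point_mass (R : realType) (T : finType) (p : fdist R T) : Prop :=
  exists x0, forall x, p x = (x == x0)%:R.

(* Steps are numbered 0, ..., H-1.  The transition out of step H-1 is part of
   the data but does not affect trajectories. *)
Record mdp (R : realType) (S A : finType) (H : nat) := MDP {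
  trans : 'I_H -> S -> A -> fdist R S;
  reward : 'I_H -> S -> A -> R;
  init : fdist R S;
  reward_ge0 : forall h s a, 0 <= reward h s a;
  reward_le1 : forall h s a, reward h s a <= 1
}.

Definition deterministic_transitions (R : realType) (S A : finType) (H : nat)
    (M : mdp R S A H) : Prop :=
  forall h s a, point_mass (trans M h s a).

Definition policy (R : realType) (S A : finType) (H : nat) : Type :=
  'I_H -> S -> fdist R A.

Definition deterministic_policy (R : realType) (S A : finType) (H : nat)
    (pi : policy R S A H) : Prop :=
  forall h s, point_mass (pi h s).

Definition traj (S A : finType) (H : nat) : finType :=
  {ffun 'I_H -> S * A}.

Definition state_at (S A : finType) (H : nat) (t : traj S A H) (h : 'I_H) : S :=
  (t h).1.

Definition action_at (S A : finType) (H : nat) (t : traj S A H) (h : 'I_H) : A :=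
  (t h).2.

(* The product over pairs (h, h') with h' = h + 1 runs over consecutive steps;
   for h = H-1 the inner product is empty. *)
Definition traj_prob (R : realType) (S A : finType) (H : nat)
    (M : mdp R S A H) (pi : policy R S A H) (t : traj S A H) : R :=
  (\prod_(h < H | h == 0%N :> nat) init M (state_at t h)) *
  (\prod_(h < H) pi h (state_at t h) (action_at t h)) *
  (\prod_(h < H) \prod_(h' < H | h' == h.+1 :> nat)
     trans M h (state_at t h) (action_at t h) (state_at t h')).

Definition total_reward (R : realType) (S A : finType) (H : nat)
    (M : mdp R S A H) (t : traj S A H) : R :=
  \sum_(h < H) reward M h (state_at t h) (action_at t h).

Definition value (R : realType) (S A : finType) (H : nat)
    (M : mdp R S A H) (pi : policy R S A H) : R :=
  \sum_(t : traj S A H) traj_prob M pi t * total_reward M t.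

Definition dataset (S A : finType) (H m : nat) : finType :=
  {ffun 'I_m -> traj S A H}.

Definition dataset_prob (R : realType) (S A : finType) (H m : nat)
    (M : mdp R S A H) (piE : policy R S A H) (D : dataset S A H m) : R :=
  \prod_(i < m) traj_prob M piE (D i).

Definition dataset_expectation (R : realType) (S A : finType) (H m : nat)
    (M : mdp R S A H) (piE : policy R S A H) (f : dataset S A H m -> R) : R :=
  \sum_(D : dataset S A H m) dataset_prob M piE D * f D.

Definition visits (S A : finType) (H m : nat)
    (D : dataset S A H m) (h : 'I_H) (s : S) : nat :=
  #|[set i : 'I_m | state_at (D i) h == s]|.

Definition action_count (S A : finType) (H m : nat)
    (D : dataset S A H m) (h : 'I_H) (s : S) (a : A) : nat :=
  #|[set i : 'I_m | (state_at (D i) h == s) && (action_at (D i) h == a)]|.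

Definition empirical (R : realType) (S A : finType) (H m : nat)
    (D : dataset S A H m) (h : 'I_H) (s : S) (a : A) : R :=
  if visits D h s == 0%N then (#|A|%:R)^-1
  else (action_count D h s a)%:R / (visits D h s)%:R.

(* The sum over the pairs (s_h, a_h) in D runs over the m trajectories, so a
   repeated pair is counted with its multiplicity. *)
Definition bc_loss (R : realType) (S A : finType) (H m : nat)
    (D : dataset S A H m) (pi : policy R S A H) : R :=
  \sum_(h < H) \sum_(i < m)
    `| pi h (state_at (D i) h) (action_at (D i) h)
       - empirical R D h (state_at (D i) h) (action_at (D i) h) |.

(* The loss does not constrain the policy at unvisited states, where the
   uniform convention built into [empirical] is imposed separately. *)
Definition is_bc (R : realType) (S A : finType) (H m : nat)
    (D : dataset S A H m) (pi : policy R S A H) : Prop :=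
  (forall pi' : policy R S A H, bc_loss D pi <= bc_loss D pi') /\
  (forall h s, visits D h s = 0%N -> forall a, pi h s a = empirical R D h s a).

Lemma empirical_ge0 (R : realType) (S A : finType) (H m : nat)
    (D : dataset S A H m) (h : 'I_H) (s : S) (a : A) :
  0 <= empirical R D h s a.
Proof. by rewrite /empirical; case: ifP => _; rewrite ?divr_ge0 ?invr_ge0. Qed.

Lemma empirical_sum1 (R : realType) (S A : finType) (H m : nat)
    (D : dataset S A H m) (h : 'I_H) (s : S) :
  (0 < #|A|)%N -> \sum_a empirical R D h s a = 1.
Proof.
move=> A0; rewrite /empirical; case: eqP => [_|/eqP v0].
  by rewrite sumr_const -[LHS]mulr_natr mulVf // pnatr_eq0 -lt0n.
rewrite -mulr_suml -natr_sum.
suff -> : (\sum_a action_count D h s a)%N = visits D h s.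
  by rewrite divff // pnatr_eq0.
rewrite /visits -sum1_card.
rewrite (partition_big (fun i => action_at (D i) h) xpredT) //=.
apply: eq_bigr => a _; rewrite /action_count -sum1_card.
by apply: eq_bigl => i; rewrite !inE.
Qed.

Lemma bc_exists (R : realType) (S A : finType) (H m : nat)
    (D : dataset S A H m) :
  (0 < #|A|)%N -> exists pi : policy R S A H, is_bc D pi.
Proof.
move=> A0.
exists (fun h s => FDist (empirical_ge0 R D h s) (empirical_sum1 R D h s A0)).
split=> // pi'; rewrite {1}/bc_loss big1.
  by apply: sumr_ge0 => h _; apply: sumr_ge0.
by move=> h _; rewrite big1 // => i _; rewrite subrr normr0.
Qed.

(* Main.v *)
(** With deterministic dynamics and a deterministic expert, the initial state
    determines the expert trajectory.  Hence behavioral cloning reproduces the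
    expert exactly from every initial state [s] that occurs in the dataset, and
    loses at most [H] from the others.  The expected loss is therefore at most
    [H * \sum_s rho s * (1 - rho s) ^+ m], and [x * (1 - x) ^+ m <= 1 / m], so
    that [C = 1] works. *)

Require Import Defs.
From mathcomp Require Import all_boot all_order all_algebra.
From mathcomp Require Import reals.

Set Implicit Arguments.
Unset Strict Implicit.
Unset Printing Implicit Defensive.

Import Order.TTheory GRing.Theory Num.Theory.
Local Open Scope ring_scope.

(** * Elementary inequalities and bounds *)

Lemma bernoulli_ineq (R : realType) (x : R) (n : nat) :
  0 <= x -> 1 + n%:R * x <= (1 + x) ^+ n.
Proof.
move=> x0; elim: n => [|n IHn]; first by rewrite mul0r addr0 expr0.
rewrite exprSr; apply: le_trans (ler_wpM2r (addr_ge0 ler01 x0) IHn).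
rewrite -natr1 !mulrDr !mulrDl !mulr1 !mul1r [n%:R * x + x]addrC !addrA.
by rewrite [1 + x + _]addrAC lerDl !mulr_ge0.
Qed.

(* By Bernoulli, [(1 - x)^n (1 + n x) <= (1 - x^2)^n <= 1]. *)
Lemma natr_mul_expr_onem_le1 (R : realType) (x : R) (n : nat) :
  0 <= x -> x <= 1 -> n%:R * (x * (1 - x) ^+ n) <= 1.
Proof.
move=> x0 x1; have y0 : 0 <= 1 - x by rewrite subr_ge0.
rewrite mulrA.
apply: (@le_trans _ _ ((1 + x) ^+ n * (1 - x) ^+ n)).
  rewrite ler_wpM2r ?exprn_ge0 //.
  by apply: le_trans (bernoulli_ineq n x0); rewrite lerDr.
rewrite -exprMn exprn_ile1 //; first by rewrite mulr_ge0 // addr_ge0.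
by rewrite mulrC -subr_sqr expr1n lerBlDr lerDl sqr_ge0.
Qed.

Lemma fdist_le1 (R : realType) (T : finType) (p : fdist R T) (x : T) : p x <= 1.
Proof.
rewrite -(pmf_sum1 p) (bigD1 x) //= lerDl.
by apply: sumr_ge0 => y _; apply: pmf_ge0.
Qed.

Lemma traj_prob_ge0 (R : realType) (S A : finType) (H : nat)
    (M : mdp R S A H) (pi : policy R S A H) (t : traj S A H) :
  0 <= traj_prob M pi t.
Proof.
rewrite /traj_prob !mulr_ge0 //; apply: prodr_ge0 => h _; try exact: pmf_ge0.
by apply: prodr_ge0 => h' _; apply: pmf_ge0.
Qed.

Lemma total_reward_ge0 (R : realType) (S A : finType) (H : nat)
    (M : mdp R S A H) (t : traj S A H) : 0 <= total_reward M t.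
Proof. by apply: sumr_ge0 => h _; apply: reward_ge0. Qed.

Lemma total_reward_le (R : realType) (S A : finType) (H : nat)
    (M : mdp R S A H) (t : traj S A H) : total_reward M t <= H%:R.
Proof.
apply: (@le_trans _ _ (\sum_(h < H) 1)); last by rewrite sumr_const card_ord.
by apply: ler_sum => h _; apply: reward_le1.
Qed.

(** * Trajectories under deterministic play *)

(** The step is a plain [nat] so that the recursion is structural; [insub] recovers the ordinal. The
    default branch is reached only past the horizon. *)
Fixpoint rollout_state (S A : finType) (H : nat) (act : 'I_H -> S -> A)
    (nxt : 'I_H -> S -> A -> S) (s : S) (k : nat) : S :=
  if k is j.+1 then
    let s' := rollout_state act nxt s j in
    if insub j is Some h then nxt h s' (act h s') else s'
  else s.

Definition rollout (S A : finType) (H : nat) (act : 'I_H -> S -> A)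
    (nxt : 'I_H -> S -> A -> S) (s : S) : traj S A H :=
  [ffun h : 'I_H =>
     (rollout_state act nxt s h, act h (rollout_state act nxt s h))].

Lemma rollout_state_succ (S A : finType) (H : nat) (act : 'I_H -> S -> A)
    (nxt : 'I_H -> S -> A -> S) (s : S) (h : 'I_H) :
  rollout_state act nxt s h.+1 =
  nxt h (rollout_state act nxt s h) (act h (rollout_state act nxt s h)).
Proof. by rewrite /= valK. Qed.

Lemma rollout_unique (S A : finType) (H : nat) (act : 'I_H.+1 -> S -> A)
    (nxt : 'I_H.+1 -> S -> A -> S) (t : traj S A H.+1) :
  (forall h, action_at t h = act h (state_at t h)) ->
  (forall h h' : 'I_H.+1, h' = h.+1 :> nat ->
     state_at t h' = nxt h (state_at t h) (action_at t h)) ->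
  t = rollout act nxt (state_at t ord0).
Proof.
move=> tact tnxt.
have st k (kH : (k < H.+1)%N) :
    state_at t (Ordinal kH) = rollout_state act nxt (state_at t ord0) k.
  elim: k kH => [|k IHk] kH; first by congr state_at; apply: val_inj.
  have kH' := ltnW kH.
  rewrite (tnxt (Ordinal kH')) // tact IHk.
  by rewrite -[k.+1]/((Ordinal kH' : nat).+1) rollout_state_succ.
apply/ffunP => -[k kH]; rewrite ffunE /= -(st k kH) -tact.
by rewrite /state_at /action_at; case: (t _).
Qed.

(** Every policy and transition factor is a 0/1 indicator, so their product is the indicator that
    [t] obeys [act] and [nxt] throughout. *)
Lemma traj_prob_rollout (R : realType) (S A : finType) (H : nat)
    (M : mdp R S A H.+1) (pi : policy R S A H.+1)
    (act : 'I_H.+1 -> S -> A) (nxt : 'I_H.+1 -> S -> A -> S) :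
  (forall h s a, pi h s a = (a == act h s)%:R) ->
  (forall h s a s', trans M h s a s' = (s' == nxt h s a)%:R) ->
  forall t, traj_prob M pi t =
    init M (state_at t ord0) * (t == rollout act nxt (state_at t ord0))%:R.
Proof.
move=> piE trE t; rewrite /traj_prob (big_pred1 ord0) // -mulrA; congr (_ * _).
case: eqP => [teq|tneq].
  have st h : state_at t h = rollout_state act nxt (state_at t ord0) h.
    by rewrite [in LHS]teq /state_at ffunE.
  have ac h : action_at t h = act h (state_at t h).
    by rewrite {1}teq /action_at ffunE /= -st.
  rewrite !big1 ?mulr1 //= => [h _|h _]; last by rewrite piE ac eqxx.
  rewrite big1 // => h' /eqP hh'.
  by rewrite trE st hh' rollout_state_succ -st -ac eqxx.
(* Conversely, a nonzero product has only nonzero factors, and these are the hypotheses of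
   [rollout_unique]. *)
apply/eqP; apply: contra_notT tneq; rewrite mulf_eq0 negb_or.
case/andP=> /prodf_neq0 piN0 /prodf_neq0 trN0; apply: rollout_unique.
  move=> h; have := piN0 h isT; rewrite piE.
  by rewrite pnatr_eq0 eqb0 negbK => /eqP.
move=> h h' /eqP hh'; have /prodf_neq0/(_ h' hh') := trN0 h isT; rewrite trE.
by rewrite pnatr_eq0 eqb0 negbK => /eqP.
Qed.

(** * Behavioral cloning along recorded trajectories *)

(** The empirical policy has loss 0, so a minimizer has loss 0 too, and each absolute value in its
    loss vanishes. *)
Lemma bc_empirical (R : realType) (S A : finType) (H m : nat)
    (D : dataset S A H m) (pi : policy R S A H) (i : 'I_m) (h : 'I_H) :
  is_bc D pi ->
  pi h (state_at (D i) h) (action_at (D i) h) =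
  empirical R D h (state_at (D i) h) (action_at (D i) h).
Proof.
case=> pi_min _.
(* The recorded action shows that [A] is inhabited, which makes the empirical frequencies a
   distribution. *)
have A0 : (0 < #|A|)%N by apply/card_gt0P; exists (action_at (D i) h).
pose emp : policy R S A H :=
  fun h s => FDist (empirical_ge0 R D h s) (empirical_sum1 R D h s A0).
have emp0 : bc_loss D emp = 0.
  rewrite /bc_loss big1 // => h' _.
  by rewrite big1 // => j _; rewrite subrr normr0.
have loss0 : bc_loss D pi == 0.
  rewrite eq_le -{1}emp0 pi_min /=.
  by apply: sumr_ge0 => h' _; apply: sumr_ge0.
move: loss0; rewrite /bc_loss psumr_eq0; last first.
  by move=> h' _; apply: sumr_ge0.
move/allP/(_ h (mem_index_enum _)); rewrite /= psumr_eq0 //.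
move/allP/(_ i (mem_index_enum _)); rewrite /= normr_eq0 subr_eq0.
by move/eqP.
Qed.

(** All visits to a state at step [h] record the same action, so the two counts agree. *)
Lemma empirical_deterministic (R : realType) (S A : finType) (H m : nat)
    (D : dataset S A H m) (act : 'I_H -> S -> A) (i : 'I_m) (h : 'I_H) :
  (forall j, action_at (D j) h = act h (state_at (D j) h)) ->
  empirical R D h (state_at (D i) h) (action_at (D i) h) = 1.
Proof.
move=> Dact; rewrite /empirical.
have v0 : visits D h (state_at (D i) h) != 0%N.
  by rewrite -lt0n; apply/card_gt0P; exists i; rewrite inE.
rewrite (negbTE v0).
suff -> : action_count D h (state_at (D i) h) (action_at (D i) h) =
    visits D h (state_at (D i) h) by rewrite divff // pnatr_eq0.
apply: eq_card => j; rewrite !inE !Dact.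
by case: (eqVneq (state_at (D j) h)) => [->|]; rewrite ?eqxx.
Qed.

(** Both policies play the recorded actions with probability 1; the initial and transition factors
    are common. *)
Lemma bc_traj_prob (R : realType) (S A : finType) (H m : nat)
    (M : mdp R S A H) (piE pi : policy R S A H) (act : 'I_H -> S -> A)
    (D : dataset S A H m) (i : 'I_m) :
  (forall h s a, piE h s a = (a == act h s)%:R) ->
  is_bc D pi ->
  (forall j h, action_at (D j) h = act h (state_at (D j) h)) ->
  traj_prob M pi (D i) = traj_prob M piE (D i).
Proof.
move=> piEE bc Dact; rewrite /traj_prob; congr (_ * _ * _).
apply: eq_bigr => h _; rewrite bc_empirical //.
by rewrite (@empirical_deterministic _ _ _ _ _ _ act) // piEE Dact eqxx.
Qed.

(** * Expectations over the expert dataset *)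

Lemma sum_prod_dataset (R : realType) (S A : finType) (H m : nat)
    (F : traj S A H -> R) :
  \sum_(D : dataset S A H m) \prod_(i < m) F (D i) = (\sum_t F t) ^+ m.
Proof. by rewrite -(bigA_distr_bigA (fun=> F)) prodr_const card_ord. Qed.

Definition starts_at (S A : finType) (H m : nat) (D : dataset S A H.+1 m)
    (s : S) : bool :=
  [exists i : 'I_m, state_at (D i) ord0 == s].

Section DeterministicExpert.
Variables (R : realType) (S A : finType) (H : nat) (M : mdp R S A H.+1).
Variables (piE : policy R S A H.+1).
Variables (act : 'I_H.+1 -> S -> A) (nxt : 'I_H.+1 -> S -> A -> S).
Hypothesis piEE : forall h s a, piE h s a = (a == act h s)%:R.
Hypothesis transE : forall h s a s', trans M h s a s' = (s' == nxt h s a)%:R.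

Let traj_probE := traj_prob_rollout piEE transE.

(** Among the trajectories with a given initial state, only the rollout has positive weight. *)
Lemma sum_expert_traj (f : traj S A H.+1 -> R) :
  \sum_t traj_prob M piE t * f t =
  \sum_s init M s * f (rollout act nxt s).
Proof.
rewrite (partition_big (fun t => state_at t ord0) xpredT) //=.
apply: eq_bigr => s _.
rewrite (bigD1 (rollout act nxt s)) /=; last by rewrite /state_at ffunE.
rewrite traj_probE.
have -> : state_at (rollout act nxt s) ord0 = s by rewrite /state_at ffunE.
rewrite eqxx mulr1 big1 ?addr0 // => t /andP[/eqP ts tneq].
by rewrite traj_probE ts (negbTE tneq) mulr0 mul0r.
Qed.

Lemma sum_expert_traj_prob : \sum_t traj_prob M piE t = 1.
Proof.
under eq_bigr do rewrite -[traj_prob _ _ _]mulr1.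
rewrite sum_expert_traj -[RHS](pmf_sum1 (init M)).
by apply: eq_bigr => s _; rewrite mulr1.
Qed.

Lemma sum_dataset_prob (m : nat) :
  \sum_(D : dataset S A H.+1 m) dataset_prob M piE D = 1.
Proof. by rewrite sum_prod_dataset sum_expert_traj_prob expr1n. Qed.

Lemma dataset_prob_ge0 (m : nat) (D : dataset S A H.+1 m) :
  0 <= dataset_prob M piE D.
Proof. by apply: prodr_ge0 => i _; apply: traj_prob_ge0. Qed.

Lemma expectation_not_starts_at (m : nat) (s : S) :
  dataset_expectation M piE
    (fun D : dataset S A H.+1 m => (~~ starts_at D s)%:R) =
  (1 - init M s) ^+ m.
Proof.
(* The indicator that [s] is missed is a product of indicators, one per trajectory, so the
   expectation factors by independence. *)
pose F t := traj_prob M piE t * (state_at t ord0 != s)%:R.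
transitivity (\sum_(D : dataset S A H.+1 m) \prod_(i < m) F (D i)).
  apply: eq_bigr => D _; rewrite big_split /=; congr (_ * _).
  case: (boolP (starts_at D s)) => [/existsP[i Di]|/existsPn nDi].
    by rewrite (bigD1 i) //= Di mul0r.
  by rewrite big1 // => i _; rewrite nDi.
rewrite sum_prod_dataset sum_expert_traj; congr (_ ^+ _).
rewrite -[X in X - _](pmf_sum1 (init M)) [in RHS](bigD1 s) //= addrAC subrr add0r.
rewrite (bigD1 s) //= /state_at ffunE /= eqxx mulr0 add0r.
by apply: eq_bigr => s' s's; rewrite ffunE /= s's mulr1.
Qed.

(** The values are compared trajectory by trajectory. A nonzero dataset probability forces every
    [D i] to be a rollout. *)
Lemma bc_value_gap (m : nat) (D : dataset S A H.+1 m)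
    (pi : policy R S A H.+1) :
  is_bc D pi -> dataset_prob M piE D != 0 ->
  value M piE - value M pi <=
  H.+1%:R * \sum_s init M s * (~~ starts_at D s)%:R.
Proof.
move=> bc /prodf_neq0 DN0.
have Droll i : D i = rollout act nxt (state_at (D i) ord0).
  have := DN0 i isT; rewrite traj_probE mulf_eq0 negb_or => /andP[_].
  by rewrite pnatr_eq0 eqb0 negbK => /eqP.
have Dact j h : action_at (D j) h = act h (state_at (D j) h).
  by rewrite Droll /action_at /state_at !ffunE.
pose f (t : traj S A H.+1) : R := (~~ starts_at D (state_at t ord0))%:R.
have -> : \sum_s init M s * (~~ starts_at D s)%:R =
    \sum_t traj_prob M piE t * f t.
  rewrite sum_expert_traj; apply: eq_bigr => s _.
  by rewrite /f /state_at ffunE.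
rewrite mulr_sumr -sumrB; apply: ler_sum => t _.
have pE0 := traj_prob_ge0 M piE t; have pB0 := traj_prob_ge0 M pi t.
have r0 := total_reward_ge0 M t; have rH := total_reward_le M t.
rewrite /f; case: (boolP (starts_at _ _)) => [/existsP[i /eqP Di]|_] /=.
  rewrite !mulr0 subr_le0.
  (* Where the expert has weight 0, the cloned term is nonnegative; otherwise [t] is the rollout
     from the start of [D i], hence [D i] itself. *)
  have [->|pN0] := eqVneq (traj_prob M piE t) 0; first by rewrite mul0r mulr_ge0.
  suff -> : t = D i by rewrite (bc_traj_prob M i piEE bc Dact).
  move: pN0; rewrite traj_probE mulf_eq0 negb_or => /andP[_].
  by rewrite -Di -Droll; rewrite pnatr_eq0 eqb0 negbK => /eqP.
(* At an uncovered start, the cloned term is dropped and the reward is bounded by the horizon. *)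
rewrite mulr1 [leRHS]mulrC; apply: le_trans (ler_wpM2l pE0 rH).
by rewrite gerBl mulr_ge0.
Qed.

Lemma bc_expected_gap (m : nat)
    (piBC : dataset S A H.+1 m -> policy R S A H.+1) :
  (forall D, is_bc D (piBC D)) ->
  value M piE - dataset_expectation M piE (fun D => value M (piBC D)) <=
  H.+1%:R * \sum_s init M s * (1 - init M s) ^+ m.
Proof.
(* The expert value becomes an average over datasets, so that the gap can be bounded dataset by
   dataset; those of probability 0 contribute nothing. *)
move=> bc; rewrite -[value M piE]mul1r -[X in X * _ - _](sum_dataset_prob m).
rewrite mulr_suml /dataset_expectation -sumrB.
apply: (@le_trans _ _ (\sum_(D : dataset S A H.+1 m) dataset_prob M piE D *
    (H.+1%:R * \sum_s init M s * (~~ starts_at D s)%:R))).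
  apply: ler_sum => D _; rewrite -mulrBr.
  have [->|DN0] := eqVneq (dataset_prob M piE D) 0; first by rewrite !mul0r.
  by rewrite ler_wpM2l ?dataset_prob_ge0 // bc_value_gap.
under eq_bigr do rewrite mulrCA.
rewrite -mulr_sumr ler_wpM2l //.
under eq_bigr do rewrite mulr_sumr.
rewrite exchange_big /=; apply: ler_sum => s _.
under eq_bigr do rewrite mulrCA.
by rewrite -mulr_sumr -expectation_not_starts_at.
Qed.

End DeterministicExpert.

Theorem theorem2 (R : realType) :
  exists C : R, 0 < C /\
  forall (S A : finType) (H : nat) (M : mdp R S A H) (piE : policy R S A H)
         (eps : R) (m : nat) (piBC : dataset S A H m -> policy R S A H),
    deterministic_transitions M ->
    deterministic_policy piE ->
    0 < eps -> eps <= H%:R ->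
    C * #|S|%:R * H%:R / eps <= m%:R ->
    (forall D : dataset S A H m, is_bc D (piBC D)) ->
    value M piE
      - dataset_expectation M piE (fun D : dataset S A H m => value M (piBC D))
      <= eps.
Proof.
exists 1; split=> // S A [|H] M piE eps m piBC.
  (* Horizon 0 would give [0 < eps <= 0]. *)
  by move=> _ _ eps0 /(lt_le_trans eps0); rewrite ltxx.
move=> detM detE eps0 epsH; rewrite mul1r ler_pdivrMr // => mlarge bc.
(* Choice over finite types turns the point masses into functions. *)
have [act piEE] := fin_all_exists (fun h => fin_all_exists (detE h)).
have [nxt transE] := fin_all_exists
  (fun h => fin_all_exists (fun s => fin_all_exists (detM h s))).
(* An initial distribution of total mass 1 needs a state; this makes [m] positive, so the goal can
   be multiplied by [m]. *)
have S0 : (0 < #|S|)%N.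
  rewrite lt0n; apply/eqP => /card0_eq S0.
  have := pmf_sum1 (init M); rewrite big_pred0 // => /eqP.
  by rewrite eq_sym oner_eq0.
have m0 : 0 < m%:R :> R.
  rewrite -(pmulr_lgt0 _ eps0); apply: lt_le_trans mlarge.
  by rewrite mulr_gt0 ?ltr0n.
apply: le_trans (bc_expected_gap piEE transE bc) _.
(* After scaling by [m], each of the [#|S|] summands is at most 1, and [#|S| * H.+1 <= m * eps]
   concludes. *)
rewrite -(ler_pM2l m0) mulrCA; apply: le_trans mlarge.
rewrite mulrC ler_wpM2r // mulr_sumr -sumr_const.
apply: ler_sum => s _.
by rewrite natr_mul_expr_onem_le1 ?pmf_ge0 ?fdist_le1.
Qed.
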